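(* Let $\theta\colon C\to D$ be a continuous covering functor between étale topological categories. Then $\theta^{-1}\colon \Omega(D)\to\Omega(C)$, $U\mapsto\theta^{-1}(U)$, is a morphism of restriction quantal frames.
   Context: Étale topological category: a small category (arrows, identities $C_o$, domain/codomain maps $\mathbf{d},\mathbf{r}$, $ab$ defined iff $\mathbf{d}(a)=\mathbf{r}(b)$) with a topology making $\mathbf{d}$, $\mathbf{r}$ and the multiplication (on composable pairs, subspace of the product) continuous, with $\mathbf{d},\mathbf{r}$ local homeomorphisms. $\Omega(C)$: open subsets of $C$ under inclusion, product $UV=\{uv:u\in U,v\in V,\mathbf{d}(u)=\mathbf{r}(v)\}$, identity $C_o$, $U^{\ast}=\mathbf{d}(U)$, $U^{+}=\mathbf{r}(U)$; it is a restriction quantal frame whose partial isometries are the open local bisections (subsets on which $\mathbf{d},\mathbf{r}$ are injective). A functor $F$ is $\mathbf{d}$-injective if $F(x)=F(y)$ and $\mathbf{d}(x)=\mathbf{d}(y)$ imply $x=y$, and $\mathbf{d}$-surjective if whenever $F(e)=\mathbf{d}(y)$ for an identity $e$ there is $x$ with $\mathbf{d}(x)=e$ and $F(x)=y$; similarly for $\mathbf{r}$. A covering functor is one that is $\mathbf{d}$-injective, $\mathbf{d}$-surjective, $\mathbf{r}$-injective and $\mathbf{r}$-surjective. A restriction quantal frame is a quantal frame $Q$ (a frame with associative multiplication distributing over arbitrary joins) that is a monoid with identity $e$ and an Ehresmann semigroup (projections $e^{\downarrow}$, operations $a^{\ast},a^{+}\in e^{\downarrow}$ fixing projections, $aa^{\ast}=a$,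 $a^{+}a=a$, $(ab)^{\ast}=(a^{\ast}b)^{\ast}$, $(ab)^{+}=(ab^{+})^{+}$) with $\ast,+$ join-preserving, such that the top $1$ is a join of partial isometries and partial isometries are closed under product (a partial isometry is $a$ with $b\le a\Rightarrow b=b^{+}a=ab^{\ast}$). A morphism of restriction quantal frames is a semigroup homomorphism preserving all joins, finite meets, the operations $\ast$ and $+$, the top element and the monoid identity, and mapping partial isometries to partial isometries. *)

(* Defs.v *)
From HB Require Import structures.
From mathcomp Require Import all_boot all_order.
From mathcomp Require Import boolp classical_sets topology.
Set Implicit Arguments. Unset Strict Implicit. Unset Printing Implicit Defensive.
Local Open Scope classical_set_scope.

(* f is a local homeomorphism: continuous, and every point has an open
   neighbourhood U on which f is injective and maps open subsets of U to
   open sets (i.e. f|U is a homeomorphism onto the open set f(U)). *)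
Definition local_homeo (T : topologicalType) (f : T -> T) : Prop :=
  continuous f /\
  forall x, exists U : set T,
    [/\ open U, U x,
        (forall y z, U y -> U z -> f y = f z -> y = z) &
        (forall V : set T, open V -> V `<=` U -> open (f @` V))].

(* An étale topological category with arrow space T.  Multiplication is a
   total function, only meaningful (and constrained) on composable pairs
   (a,b) with dom a = cod b. *)
Record etale_cat (T : topologicalType) := EtaleCat {
  dom : T -> T;
  cod : T -> T;
  mul : T -> T -> T;
  idts : set T;
  dom_idts : forall a, idts (dom a);
  cod_idts : forall a, idts (cod a);
  idts_dom : forall e, idts e -> dom e = e;
  idts_cod : forall e, idts e -> cod e = e;
  dom_mul : forall a b, dom a = cod b -> dom (mul a b) = dom b;
  cod_mul : forall a b, dom a = cod b -> cod (mul a b) = cod a;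
  mulA : forall a b c, dom a = cod b -> dom b = cod c ->
           mul (mul a b) c = mul a (mul b c);
  mul_dom : forall a, mul a (dom a) = a;
  mul_cod : forall a, mul (cod a) a = a;
  dom_cont : continuous dom;
  cod_cont : continuous cod;
  mul_cont : {within [set p : T * T | dom p.1 = cod p.2],
               continuous (fun p : T * T => mul p.1 p.2)};
  dom_lh : local_homeo dom;
  cod_lh : local_homeo cod
}.

Section Omega.
Variables (T : topologicalType) (C : etale_cat T).

Definition omul (U V : set T) : set T :=
  [set x | exists u v, [/\ U u, V v, dom C u = cod C v & x = mul C u v]].
Definition ostar (U : set T) : set T := dom C @` U.
Definition oplus (U : set T) : set T := cod C @` U.
Definition oone : set T := idts C.

(* partial isometry of the quantal frame Omega(C) (elements = open sets,
   order = inclusion):  b <= a  implies  b = b^+ a = a b^*. *)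
Definition opisom (A : set T) : Prop :=
  open A /\ forall B : set T, open B -> B `<=` A ->
    B = omul (oplus B) A /\ B = omul A (ostar B).
End Omega.

Definition is_functor (T1 T2 : topologicalType) (C : etale_cat T1)
  (D : etale_cat T2) (F : T1 -> T2) : Prop :=
  [/\ forall a b, dom C a = cod C b -> F (mul C a b) = mul D (F a) (F b),
      forall a, F (dom C a) = dom D (F a),
      forall a, F (cod C a) = cod D (F a) &
      forall e, idts C e -> idts D (F e)].

Definition d_injective T1 T2 (C : etale_cat T1) (D : etale_cat T2) (F : T1 -> T2) :=
  forall x y, F x = F y -> dom C x = dom C y -> x = y.
Definition r_injective T1 T2 (C : etale_cat T1) (D : etale_cat T2) (F : T1 -> T2) :=
  forall x y, F x = F y -> cod C x = cod C y -> x = y.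
Definition d_surjective T1 T2 (C : etale_cat T1) (D : etale_cat T2) (F : T1 -> T2) :=
  forall e y, idts C e -> F e = dom D y -> exists x, dom C x = e /\ F x = y.
Definition r_surjective T1 T2 (C : etale_cat T1) (D : etale_cat T2) (F : T1 -> T2) :=
  forall e y, idts C e -> F e = cod D y -> exists x, cod C x = e /\ F x = y.

Definition covering_functor T1 T2 (C : etale_cat T1) (D : etale_cat T2) (F : T1 -> T2) :=
  [/\ is_functor C D F, d_injective C D F, d_surjective C D F,
      r_injective C D F & r_surjective C D F].

(* h : Omega(D) -> Omega(C) (given on all sets, only its restriction to open
   sets matters) is a morphism of restriction quantal frames. *)
Definition rqf_morphism T2 T1 (D : etale_cat T2) (C : etale_cat T1)
  (h : set T2 -> set T1) : Prop :=
  [/\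
      forall U, open U -> open (h U),
      forall U V, open U -> open V -> h (omul D U V) = omul C (h U) (h V),
      forall (I : Type) (F : I -> set T2), (forall i, open (F i)) ->
        h (\bigcup_i F i) = \bigcup_i h (F i),
      (forall U V, open U -> open V -> h (U `&` V) = h U `&` h V) /\ h setT = setT &
      [/\ (forall U, open U -> h (ostar D U) = ostar C (h U)),
          (forall U, open U -> h (oplus D U) = oplus C (h U)),
          h (oone D) = oone C &
          (forall U, opisom D U -> opisom C (h U))]].

(* Main.v *)
Require Import Defs.
From mathcomp Require Import all_boot all_order.
From mathcomp Require Import boolp classical_sets topology.
Local Open Scope classical_set_scope.

(* Then, for a covering functor theta, the
   preimage map theta^-1 is shown to commute with each operation separately:
   products and star use d-injectivity and d-surjectivity, plus uses
   r-surjectivity, the identity uses the fact that theta reflects identities,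
   and local bisections are pulled back to local bisections by d- and
   r-injectivity.  Joins and meets commute with preimages for set-theoretic
   reasons, and openness is preserved by continuity. *)

Definition bisection {T : topologicalType} (C : etale_cat T) (U : set T) :=
  (forall a b, U a -> U b -> dom C a = dom C b -> a = b) /\
  (forall a b, U a -> U b -> cod C a = cod C b -> a = b).

Section PartialIsometries.
Variables (T : topologicalType) (C : etale_cat T).

(* On a cod-injective set A, every B inside A is recovered as B^+ A:
   an arrow cod(b) a with b in B, a in A forces a = b. *)
Lemma omul_oplus_sub (A B : set T) :
  (forall a b, A a -> A b -> cod C a = cod C b -> a = b) ->
  B `<=` A -> B = omul C (oplus C B) A.
Proof.
move=> cod_inj BA; apply/seteqP; split=> x.
- move=> Bx; exists (cod C x), x; split; first by exists x.
  + exact: BA.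
  + by rewrite idts_dom //; exact: cod_idts.
  + by rewrite mul_cod.
- move=> [_ [a [[b Bb <-] Aa e ->]]].
  rewrite idts_dom in e; last exact: cod_idts.
  by rewrite e mul_cod -(cod_inj b a (BA b Bb) Aa e).
Qed.

Lemma omul_ostar_sub (A B : set T) :
  (forall a b, A a -> A b -> dom C a = dom C b -> a = b) ->
  B `<=` A -> B = omul C A (ostar C B).
Proof.
move=> dom_inj BA; apply/seteqP; split=> x.
- move=> Bx; exists x, (dom C x); split; first exact: BA.
  + by exists x.
  + by rewrite idts_cod //; exact: dom_idts.
  + by rewrite mul_dom.
- move=> [a [_ [Aa [b Bb <-] e ->]]].
  rewrite idts_cod in e; last exact: dom_idts.
  by rewrite -e mul_dom (dom_inj a b Aa (BA b Bb) e).
Qed.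

(* A partial isometry is cod-injective: intersecting it with an open set W
   on which cod is injective gives B with B = B^+ U, and B^+ U contains every
   arrow of U with the same codomain as an arrow of B. *)
Lemma opisom_cod_inj (U : set T) :
  opisom C U -> forall a b, U a -> U b -> cod C a = cod C b -> a = b.
Proof.
move=> [oU pisoU] a b Ua Ub e.
have [_ /(_ a) [W [oW Wa Winj _]]] := cod_lh C.
have [UW_eq _] := pisoU _ (openI oU oW) (@subIsetl _ U W).
suff [_ Wb] : (U `&` W) b by exact: Winj.
rewrite UW_eq; exists (cod C a), b; split=> //; first by exists a.
  by rewrite idts_dom ?e //; exact: cod_idts.
by rewrite e mul_cod.
Qed.

Lemma opisom_dom_inj (U : set T) :
  opisom C U -> forall a b, U a -> U b -> dom C a = dom C b -> a = b.
Proof.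
move=> [oU pisoU] a b Ua Ub e.
have [_ /(_ a) [W [oW Wa Winj _]]] := dom_lh C.
have [_ UW_eq] := pisoU _ (openI oU oW) (@subIsetl _ U W).
suff [_ Wb] : (U `&` W) b by exact: Winj.
rewrite UW_eq; exists b, (dom C a); split=> //; first by exists a.
  by rewrite idts_cod ?e //; exact: dom_idts.
by rewrite e mul_dom.
Qed.

Lemma opisomP (U : set T) : opisom C U <-> open U /\ bisection C U.
Proof.
split.
- move=> pU; split; first by case: pU.
  by split; [exact: opisom_dom_inj | exact: opisom_cod_inj].
- move=> [oU [dom_inj cod_inj]]; split=> // B _ BU.
  by split; [exact: omul_oplus_sub | exact: omul_ostar_sub].
Qed.

End PartialIsometries.

Lemma preimage_open (T1 T2 : topologicalType) (f : T1 -> T2) (U : set T2) :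
  continuous f -> open U -> open (f @^-1` U).
Proof. by move=> cf oU; apply: open_comp => // x _; exact: cf. Qed.

Section CoveringPreimage.
Variables (T1 T2 : topologicalType) (C : etale_cat T1) (D : etale_cat T2).
Variable theta : T1 -> T2.
Hypothesis theta_mul : forall a b, dom C a = cod C b ->
  theta (Defs.mul C a b) = Defs.mul D (theta a) (theta b).
Hypothesis theta_dom : forall a, theta (dom C a) = dom D (theta a).
Hypothesis theta_cod : forall a, theta (cod C a) = cod D (theta a).
Hypothesis theta_idts : forall e, idts C e -> idts D (theta e).
Hypothesis theta_dinj : d_injective C D theta.
Hypothesis theta_dsurj : d_surjective C D theta.
Hypothesis theta_rinj : r_injective C D theta.
Hypothesis theta_rsurj : r_surjective C D theta.

(* A d-injective functor reflects identities: if theta x is an identity then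
   x and dom x have the same image and the same domain. *)
Lemma covering_reflects_idts x : idts D (theta x) -> idts C x.
Proof.
move=> idx; suff <- : dom C x = x by exact: dom_idts.
apply: theta_dinj; last by rewrite idts_dom //; exact: dom_idts.
by rewrite theta_dom idts_dom.
Qed.

(* theta^-1 (U V) = theta^-1 U theta^-1 V: a factorisation theta x = u v is
   lifted by d-surjectivity, first v at dom x, then u at the codomain of the
   lift of v, and d-injectivity identifies the product of the lifts with x. *)
Lemma preimage_omul (U V : set T2) :
  theta @^-1` omul D U V = omul C (theta @^-1` U) (theta @^-1` V).
Proof.
apply/seteqP; split=> x /=.
- move=> [u [v [Uu Vv duv ex]]].
  have [v' [dv' tv']] : exists v', dom C v' = dom C x /\ theta v' = v.
    by apply: theta_dsurj; [exact: dom_idts | rewrite theta_dom ex dom_mul].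
  have [u' [du' tu']] : exists u', dom C u' = cod C v' /\ theta u' = u.
    by apply: theta_dsurj; [exact: cod_idts | rewrite theta_cod tv' duv].
  exists u', v'; split; rewrite /= ?tu' ?tv' //.
  by apply: theta_dinj; rewrite ?theta_mul ?tu' ?tv' // dom_mul.
- move=> [u [v [Uu Vv duv ->]]].
  rewrite theta_mul //; exists (theta u), (theta v); split=> //.
  by rewrite -theta_dom -theta_cod duv.
Qed.

(* theta^-1 U^* = (theta^-1 U)^* : a preimage x of dom u is an identity,
   and u lifts to an arrow with domain x by d-surjectivity. *)
Lemma preimage_ostar (U : set T2) :
  theta @^-1` ostar D U = ostar C (theta @^-1` U).
Proof.
apply/seteqP; split=> x /=.
- move=> [u Uu e].
  have idx : idts C x by apply: covering_reflects_idts; rewrite -e; exact: dom_idts.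
  have [y [dy ty]] := theta_dsurj _ _ idx (esym e).
  by exists y; rewrite /= ?ty.
- by move=> [y Uy <-]; exists (theta y); rewrite ?theta_dom.
Qed.

(* theta^-1 U^+ = (theta^-1 U)^+, using r-surjectivity instead. *)
Lemma preimage_oplus (U : set T2) :
  theta @^-1` oplus D U = oplus C (theta @^-1` U).
Proof.
apply/seteqP; split=> x /=.
- move=> [u Uu e].
  have idx : idts C x by apply: covering_reflects_idts; rewrite -e; exact: cod_idts.
  have [y [dy ty]] := theta_rsurj _ _ idx (esym e).
  by exists y; rewrite /= ?ty.
- by move=> [y Uy <-]; exists (theta y); rewrite ?theta_cod.
Qed.

(* theta^-1 D_o = C_o: functors preserve identities and theta reflects them. *)
Lemma preimage_oone : theta @^-1` oone D = oone C.
Proof.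
apply/seteqP; split=> x /=; first exact: covering_reflects_idts.
exact: theta_idts.
Qed.

(* Local bisections pull back to local bisections: two arrows of
   theta^-1 U with equal domains (codomains) have images in U with equal
   domains (codomains), hence equal images, hence are equal. *)
Lemma preimage_bisection (U : set T2) :
  bisection D U -> bisection C (theta @^-1` U).
Proof.
move=> [dom_inj cod_inj]; split=> a b Ua Ub e.
- by apply: theta_dinj => //; apply: dom_inj; rewrite // -!theta_dom e.
- by apply: theta_rinj => //; apply: cod_inj; rewrite // -!theta_cod e.
Qed.

End CoveringPreimage.

Theorem mainTheorem4 (T1 T2 : topologicalType) (C : etale_cat T1) (D : etale_cat T2)
  (theta : T1 -> T2) :
  continuous theta -> covering_functor C D theta ->
  rqf_morphism D C (fun U : set T2 => theta @^-1` U)%classic.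
Proof.
move=> theta_cont [[Fmul Fdom Fcod Fid] dinj dsurj rinj rsurj].
split.
- by move=> U; exact: preimage_open.
- by move=> U V _ _; exact: preimage_omul.
- by move=> I F _; rewrite preimage_bigcup.
- by split=> // U V _ _; rewrite preimageI.
- split.
  + by move=> U _; exact: preimage_ostar.
  + by move=> U _; exact: preimage_oplus.
  + exact: preimage_oone.
  + move=> U /opisomP [oU bisU]; apply/opisomP; split.
      exact: preimage_open.
    exact: preimage_bisection.
Qed.
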